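(* Let $f(x,y)=y^2+Axy+Bx^2\in\mathbb{Z}[x,y]$ satisfy $f(n,k)\ge0$ for all integers $n,k\ge0$, and let $a_n(q)=\sum_{k=0}^n {n\brack k}_q^2{n+k\brack k}_q^2q^{f(n,k)}$. For $P\in\mathbb{C}[x,y]$ put $a_{n,P}=\sum_{k=0}^n\binom{n}{k}^2\binom{n+k}{n}^2P(n,k)$. For all $n\ge1$ and $\omega\in\mu_n$, writing $e=\mathrm{ord}(\omega)$: $$a_n(\omega)=a_{n/e}(1),\qquad \omega a_n'(\omega) = e^2\, a_{n/e,\ 2xy-y^2+f(x,y)},$$ $$\omega^2a_n''(\omega) = e^4\, a_{n/e,\ (2xy-y^2+f(x,y))^2+\frac{x^2y}{3}-\frac{(x-y)^2}{6}} + e^2\, a_{n/e,\ \frac{x^2}{6}-2xy+y^2-f(x,y)}.$$ In particular, for all $m\ge1$ and $n\ge2$ with $\gcd(n,6)=1$, $a_{nm}(q)\equiv f_0(q)+f_1(q)[n]_q+f_2(q)[n]_q^2\pmod{[n]_q^3}$, where $f_0,f_1,f_2\in\mathbb{Z}[q]$ are the first three $[n]_q$-digits of $a_{nm}(q)$, given by $f_0 = G_{g_0,n}$, $f_1 = \frac{q-1}{n}\big(G_{g_1,n}-qG_{g_0,n}'\big)$, $f_2 = \frac{(q-1)^2}{2n^2}\big(G_{g_2,n}+G''_{g_0,n}q^2+(qG'_{g_0,n}-G_{g_1,n})(n-1)+2q(G'_{g_0,n}-G'_{g_1,n})\big)$, with $g_0(d)=a_{md}(1)$, $g_1(d)=a_{mn}'(\omega_n^d)\omega_n^d$,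 $g_2(d)=a_{mn}''(\omega_n^d)\omega_n^{2d}$ for $d\in D_n$.
   Context: $[n]_q = \frac{q^n-1}{q-1}$, ${n \brack k}_q = \frac{[n]_q!}{[k]_q![n-k]_q!}$ with $[n]_q!=\prod_{i=1}^n[i]_q$. $\omega_n=e^{2\pi i/n}$, $\mu_n=\{\omega_n^j\}$, $\mathrm{ord}(\omega)$ is the order of $\omega$; primes denote derivatives in $q$. $\mu$ is the Möbius function, $D_n$ the set of divisors of $n$ other than $n$, and for $g:D_n\to\mathbb{C}$, $G_{g,n}(q)=\sum_{d\in D_n}\frac{[n]_q}{[n/d]_q}\cdot\frac{\sum_{e\mid d}\mu(d/e)g(e)}{d}$. For $F\in\mathbb{C}[q]$ and $n>1$, writing uniquely $F=\sum_{i\ge0}f_i[n]_q^i$ with $\deg f_i<n-1$, $f_i$ is the $i$-th $[n]_q$-digit of $F$. *)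

(* Defs.v *)
From HB Require Import structures.
From mathcomp Require Import all_boot all_order all_algebra polyXY.
From mathcomp Require Import complex.
From mathcomp Require Import reals trigo.

Set Implicit Arguments.
Unset Strict Implicit.
Unset Printing Implicit Defensive.

Import Order.TTheory GRing.Theory Num.Theory.
Local Open Scope ring_scope.

Section QAnalogues.
Variable R : idomainType.

(* All the divisors below are monic, so that the pseudo-division of [{poly R}]
   is the division of polynomials; the quotients are moreover exact. *)
Definition qint (n : nat) : {poly R} := ('X^n - 1) %/ ('X - 1).

Definition qfact (n : nat) : {poly R} := \prod_(1 <= i < n.+1) qint i.

Definition qbinom (n k : nat) : {poly R} :=
  qfact n %/ (qfact k * qfact (n - k)).

End QAnalogues.

(* Bivariate polynomials are polynomials in 'X (that is, x) whose coefficients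
   are polynomials in 'Y (that is, y); [P.[a, b]] is P(a, b). *)
Definition quadf (R : comNzRingType) (A B : int) : {poly {poly R}} :=
  'Y ^+ 2 + A%:~R * ('X * 'Y) + B%:~R * 'X ^+ 2.

(* The absolute value only serves to make the exponent a natural number: it is
   meant to be used when f takes nonnegative values on natural numbers. *)
Definition qapery (A B : int) (n : nat) : {poly int} :=
  \sum_(k < n.+1) qbinom int n k ^+ 2 * qbinom int (n + k) k ^+ 2
                  * 'X^(`|(quadf int A B).[n%:Z, k%:Z]|%N).

Definition moebius (n : nat) : int :=
  if (0 < n)%N && all (fun p => logn p n == 1%N) (primes n)
  then (-1) ^+ size (primes n) else 0.

Section OverField.
Variable K : fieldType.

Definition apery_wt (P : {poly {poly K}}) (n : nat) : K :=
  \sum_(k < n.+1) ('C(n, k) ^ 2 * 'C(n + k, n) ^ 2)%:R * P.[n%:R, k%:R].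

(* Only the values of g at the proper divisors of n are used. *)
Definition Gpoly (g : nat -> K) (n : nat) : {poly K} :=
  \sum_(d <- divisors n | d != n)
    ((\sum_(e <- divisors d) (moebius (d %/ e))%:~R * g e) / d%:R)
      *: (qint K n %/ qint K (n %/ d)).

(* [s] is the list of the digits of F in base [n]_q, possibly padded with
   zeros; [size p < n] means deg p < n - 1. *)
Definition q_expansion (n : nat) (F : {poly K}) (s : seq {poly K}) : Prop :=
  all (fun p : {poly K} => (size p < n)%N) s
  /\ F = \sum_(i < size s) s`_i * qint K n ^+ i.

Definition is_digit (n : nat) (F : {poly K}) (i : nat) (f : {poly K}) : Prop :=
  exists2 s : seq {poly K}, q_expansion n F s & f = s`_i.

End OverField.

Section RootsOfUnity.
Variable R : realType.

(* e^(2 pi i / n), by Euler's formula. *)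
Definition omega (n : nat) : complex R :=
  Complex (cos (2 * pi / n%:R)) (sin (2 * pi / n%:R)).

Definition in_mu (n : nat) (w : complex R) : Prop :=
  exists j : nat, w = omega n ^+ j.

End RootsOfUnity.

(* Main.v *)
(* Let theta = q d/dq.  If F(w) <> 0, the numbers F(w), (theta log F)(w) and
   (theta^2 log F)(w) determine F, F', F'' at w, and the last two are additive
   in F.  At a primitive e-th root of unity w, divide each q-integer [m] with
   e | m in a q-factorial by [e]: the quotient does not vanish at w and its
   logarithmic derivatives are explicit once the sums over 0 < r < e of
   w^r/(w^r - 1) and w^r/(w^r - 1)^2 are known; these follow from
   [e] = prod_r (q - w^r) at q = 1.  This settles the terms of a_n with e | k.
   If e does not divide k then [n choose k] has a zero at w, hence the term has
   a double zero and only contributes 2 (theta [n choose k])^2 times the rest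
   to theta^2 a_n.

   For the digits, Moebius inversion gives G_g(w) = g(n/e) at every w <> 1 of
   order e in mu_n.  Differentiating a = f0 + f1 [n] + f2 [n]^2 + ... twice at w
   expresses f0, f1, f2 there, and both sides have degree < n - 1: since n is
   prime to 6, n/d >= 5 for d in D_n, so that deg G_g <= n - 5. *)
Require Import Defs.
From HB Require Import structures.
From mathcomp Require Import all_boot all_order all_algebra polyXY.
From mathcomp Require Import complex.
From mathcomp Require Import reals trigo.
From mathcomp Require Import ring lra zify.

Set Implicit Arguments.
Unset Strict Implicit.
Unset Printing Implicit Defensive.

Import Order.TTheory GRing.Theory Num.Theory.
Local Open Scope ring_scope.

(** * q-integers, q-factorials and q-binomials over an integral domain *)

Section QIntegers.
Variable R : idomainType.
Implicit Types (m n k e j : nat).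

Lemma qintE n : qint R n = \sum_(i < n) 'X^i.
Proof.
by rewrite /qint subrX1 Pdiv.IdomainMonic.mulKp // monicXsubC.
Qed.

Lemma qint_mulX1 n : qint R n * ('X - 1) = 'X^n - 1.
Proof. by rewrite qintE mulrC -subrX1. Qed.

Lemma qint0 : qint R 0 = 0.
Proof. by rewrite qintE big_ord0. Qed.

Lemma qintD m n : qint R (m + n) = qint R m + 'X^m * qint R n.
Proof.
rewrite !qintE big_split_ord /= mulr_sumr; congr (_ + _).
by apply: eq_bigr => i _; rewrite exprD.
Qed.

Lemma polyX_subr1_neq0 : 'X - 1 != 0 :> {poly R}.
Proof. exact: (monic_neq0 (monicXsubC 1)). Qed.

Lemma qint_mul e j : qint R (e * j) = qint R e * (qint R j \Po 'X^e).
Proof.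
apply: (mulIf polyX_subr1_neq0).
rewrite mulrAC !qint_mulX1 !qintE exprM raddf_sum /= subrX1; congr (_ * _).
by apply: eq_bigr => i _; rewrite comp_Xn_poly.
Qed.

Lemma qint_monic n : (0 < n)%N -> qint R n \is monic.
Proof.
move=> n_gt0; rewrite -(monicMr _ (monicXsubC 1)) qint_mulX1.
by rewrite monicXnsubC.
Qed.

Lemma size_qint n : size (qint R n) = n.
Proof.
case: n => [|n]; first by rewrite qint0 size_poly0.
have /(congr1 (fun p : {poly R} => size p)) := qint_mulX1 n.+1.
rewrite size_Mmonic ?monicXsubC ?monic_neq0 ?qint_monic //.
by rewrite size_XsubC size_XnsubC // addn2 => -[].
Qed.

Lemma qfact0 : qfact R 0 = 1.
Proof. by rewrite /qfact big_nil. Qed.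

Lemma qfactS n : qfact R n.+1 = qfact R n * qint R n.+1.
Proof. by rewrite /qfact big_nat_recr. Qed.

Lemma qfact_monic n : qfact R n \is monic.
Proof.
elim: n => [|n IHn]; first by rewrite qfact0 monic1.
by rewrite qfactS monicMl // qint_monic.
Qed.

(** The quotients obey the q-Pascal rule: [m + n + 2] = [m + 1] + q^(m+1) [n + 1] reduces the pair
    (m + 1, n + 1) to (m, n + 1) and (m + 1, n). This makes the division in [qbinom] exact. *)
Lemma qfactD_dvd m n :
  exists G, qfact R (m + n) = G * (qfact R m * qfact R n).
Proof.
elim: {m n}(m + n)%N {1 4}m {1 4}n (erefl (m + n)%N) => [|s IHs] m n.
  by case: m n => [|m] [|n] // _; exists 1; rewrite qfact0 !mul1r.
case: m n => [|m] [|n] mn //.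
- by exists 1; rewrite -mn qfact0 !mul1r.
- by exists 1; rewrite -mn addn0 qfact0 mulr1 mul1r.
have [G GE] := IHs m n.+1 ltac:(lia); have [H HE] := IHs m.+1 n ltac:(lia).
exists (G + 'X^(m.+1) * H); rewrite qfactS -mn qintD [LHS]mulrDr {1}GE.
rewrite mulrCA HE !qfactS; ring.
Qed.

Lemma qbinomE n k :
  (k <= n)%N -> qbinom R n k * (qfact R k * qfact R (n - k)) = qfact R n.
Proof.
move=> le_kn; have [G] := qfactD_dvd k (n - k); rewrite subnKC // => nE.
by rewrite /qbinom nE Pdiv.IdomainMonic.mulpK // monicMl qfact_monic.
Qed.

End QIntegers.

Section MapQIntegers.
Variables (R S : idomainType) (h : {rmorphism R -> S}).

Lemma map_qint n : map_poly h (qint R n) = qint S n.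
Proof.
rewrite !qintE rmorph_sum /=.
by apply: eq_bigr => i _; rewrite map_polyXn.
Qed.

Lemma map_qfact n : map_poly h (qfact R n) = qfact S n.
Proof.
rewrite /qfact rmorph_prod /=.
by apply: eq_bigr => i _; rewrite map_qint.
Qed.

Lemma map_qbinom n k :
  (k <= n)%N -> map_poly h (qbinom R n k) = qbinom S n k.
Proof.
move=> le_kn; have nz : qfact S k * qfact S (n - k) != 0.
  by rewrite mulf_neq0 // monic_neq0 // qfact_monic.
apply: (mulIf nz); rewrite qbinomE // -!map_qfact -!rmorphM /=.
by rewrite qbinomE.
Qed.

End MapQIntegers.

(** * Logarithmic derivatives of order two *)

Section LogJets.
Variable K : numFieldType.
Implicit Types (F G : {poly K}) (w v l s : K).

(** This is theta = q d/dq. It is locked so that the rewriting rules for products do not open it. *)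
Definition qderiv F := locked ('X * F^`()).

Lemma qderivE F : qderiv F = 'X * F^`().
Proof. by rewrite /qderiv -lock. Qed.

Lemma qderivM F G : qderiv (F * G) = qderiv F * G + F * qderiv G.
Proof. by rewrite !qderivE derivM; ring. Qed.

Lemma qderivD F G : qderiv (F + G) = qderiv F + qderiv G.
Proof. by rewrite !qderivE derivD mulrDr. Qed.

Lemma qderivN F : qderiv (- F) = - qderiv F.
Proof. by rewrite !qderivE derivN mulrN. Qed.

Lemma qderivZ (c : K) F : qderiv (c *: F) = c *: qderiv F.
Proof. by rewrite !qderivE derivZ scalerAr. Qed.

Lemma qderiv_XsubC (c : K) : qderiv ('X - c%:P) = 'X.
Proof. by rewrite qderivE derivXsubC mulr1. Qed.

Lemma size_qderiv F : (size (qderiv F) <= size F)%N.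
Proof.
rewrite qderivE; have [->|F'_neq0] := eqVneq F^`() 0.
  by rewrite mulr0 size_poly0.
rewrite mulrC size_mulX // lt_size_deriv //.
by apply: contra F'_neq0 => /eqP ->; rewrite deriv0.
Qed.

Lemma qderivMn F n : qderiv (F *+ n) = qderiv F *+ n.
Proof. by rewrite !qderivE derivMn mulrnAr. Qed.

Lemma qderivC (c : K) : qderiv c%:P = 0.
Proof. by rewrite qderivE derivC mulr0. Qed.

Lemma qderivXn n : qderiv 'X^n = 'X^n *+ n.
Proof.
rewrite qderivE derivXn; case: n => [|n]; first by rewrite !mulr0n mulr0.
by rewrite mulrnAr -exprS.
Qed.

Lemma qderiv_sum I (r : seq I) (P : pred I) (F : I -> {poly K}) :
  qderiv (\sum_(i <- r | P i) F i) = \sum_(i <- r | P i) qderiv (F i).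
Proof.
rewrite qderivE raddf_sum mulr_sumr /=.
by apply: eq_bigr => i _; rewrite qderivE.
Qed.

(* If F = exp(u) near w with v = F(w), then l = (q d/dq) u (w) and
   s = (q d/dq)^2 u (w). *)
Definition logjet w F v l s :=
  [/\ F.[w] = v, (qderiv F).[w] = v * l
    & (qderiv (qderiv F)).[w] = v * (l ^+ 2 + s)].

Lemma logjetM w F G v1 v2 l1 l2 s1 s2 :
    logjet w F v1 l1 s1 -> logjet w G v2 l2 s2 ->
  logjet w (F * G) (v1 * v2) (l1 + l2) (s1 + s2).
Proof.
move=> [F0 F1 F2] [G0 G1 G2];
  rewrite /logjet !(qderivM, qderivD) !(hornerD, hornerM).
rewrite F0 F1 F2 G0 G1 G2; split; ring.
Qed.

Lemma logjet1 w : logjet w 1 1 0 0.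
Proof.
rewrite /logjet -polyC1 qderivC -(polyC0 K) qderivC !hornerC.
by split; ring.
Qed.

Lemma logjet_prod w I (r : seq I) (P : pred I)
    (F : I -> {poly K}) (v l s : I -> K) :
    (forall i, P i -> logjet w (F i) (v i) (l i) (s i)) ->
  logjet w (\prod_(i <- r | P i) F i) (\prod_(i <- r | P i) v i)
    (\sum_(i <- r | P i) l i) (\sum_(i <- r | P i) s i).
Proof.
move=> jF; elim: r => [|i r IHr]; first by rewrite !big_nil; apply: logjet1.
by rewrite !big_cons; case: ifP => // /jF jFi; apply: logjetM.
Qed.

Lemma logjetX w F v l s n :
  logjet w F v l s -> logjet w (F ^+ n) (v ^+ n) (l *+ n) (s *+ n).
Proof.
move=> jF; elim: n => [|n IHn]; first exact: logjet1.
by rewrite !exprS !mulrS; apply: logjetM.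
Qed.

Lemma logjetXn w n : logjet w 'X^n (w ^+ n) n%:R 0.
Proof.
rewrite /logjet qderivXn qderivMn qderivXn !hornerMn hornerXn.
by split=> //; ring.
Qed.

Lemma logjet_uniq w F v l s v' l' s' : v != 0 ->
    logjet w F v l s -> logjet w F v' l' s' ->
  [/\ v' = v, l' = l & s' = s].
Proof.
move=> v_neq0 [F0 F1 F2] []; rewrite F0 F1 F2 => <- /(mulfI v_neq0) <-.
by move/(mulfI v_neq0)/addrI.
Qed.

(** As [G] does not vanish at [w], the Leibniz formulas for [F * G] can be solved successively for
    the three values of [F]. *)
Lemma logjet_div w F G v1 v2 l1 l2 s1 s2 : v2 != 0 ->
    logjet w (F * G) v1 l1 s1 -> logjet w G v2 l2 s2 ->
  logjet w F (v1 / v2) (l1 - l2) (s1 - s2).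
Proof.
move=> nz [H0 H1 H2] [G0 G1 G2]; rewrite /logjet.
move: H0 H1 H2; rewrite !(qderivM, qderivD) !(hornerD, hornerM) G0 G1 G2.
move: F.[w] (qderiv F).[w] (qderiv (qderiv F)).[w] => a b c H0 H1 H2.
have aE : a = v1 / v2 by rewrite -H0 mulfK.
have bE : b = v1 / v2 * (l1 - l2).
  by apply: (mulIf nz); rewrite -[LHS](addrK (a * (v2 * l2))) H1 aE; field.
split=> //; apply: (mulIf nz).
rewrite -[LHS](addrK (b * (v2 * l2) + (b * (v2 * l2) + a * (v2 * (l2 ^+ 2 +
  s2))))).
by rewrite addrA H2 aE bE; field.
Qed.

Lemma logjet_XsubC w (c : K) : w != c ->
  logjet w ('X - c%:P) (w - c) (w / (w - c)) (- (w * c) / (w - c) ^+ 2).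
Proof.
rewrite -subr_eq0 => nz; rewrite /logjet qderiv_XsubC.
have -> : qderiv 'X = 'X :> {poly K} by rewrite qderivE derivX mulr1.
by rewrite hornerXsubC hornerX; split=> //; field.
Qed.

End LogJets.

(** * q-factorials at roots of unity *)

Section RootOfUnity.
Variable K : numFieldType.
Implicit Types (m n k r : nat) (x : K).

Lemma sum_natr n : \sum_(i < n) i%:R = n%:R * (n%:R - 1) / 2 :> K.
Proof.
elim: n => [|n IHn]; first by rewrite big_ord0 !mul0r.
by rewrite big_ord_recr /= IHn -natr1; field.
Qed.

Lemma sum_natr_sqr n :
  \sum_(i < n) i%:R ^+ 2 = n%:R * (n%:R - 1) * (2 * n%:R - 1) / 6 :> K.
Proof.
elim: n => [|n IHn]; first by rewrite big_ord0 !mul0r.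
by rewrite big_ord_recr /= IHn -natr1; field.
Qed.

(** Every monomial q^(e i) equals 1 at [x], so the values are power sums of e i for i < n: the first
    logarithmic derivative is e times the mean of 0, ..., n - 1, and the second is e^2 times their
    variance. *)
Lemma logjet_qint_comp e x n : x ^+ e = 1 ->
  logjet x (qint K n \Po 'X^e) n%:R (e%:R * (n%:R - 1) / 2)
    (e%:R ^+ 2 * (n%:R ^+ 2 - 1) / 12).
Proof.
move=> xe1; have xei (i : nat) : x ^+ (e * i) = 1 by rewrite exprM xe1 expr1n.
have -> : qint K n \Po 'X^e = \sum_(i < n) 'X^(e * i).
  rewrite qintE raddf_sum /=; apply: eq_bigr => i _.
  by rewrite comp_Xn_poly exprM.
rewrite /logjet !qderiv_sum !horner_sum.
under eq_bigr do rewrite hornerXn xei.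
under [X in X = _ * _]eq_bigr do rewrite qderivXn hornerMn hornerXn xei natrM.
under [X in X = _ * (_ + _)]eq_bigr
  do rewrite qderivXn qderivMn qderivXn !hornerMn hornerXn xei -mulrnA natrM
     -expr2 natrM exprMn.
rewrite -!mulr_sumr sum_natr sum_natr_sqr.
by split; [rewrite sumr_const card_ord | field | field].
Qed.

(** The value at x of (q d/dq)^2 log (q - 1). *)
Definition logsqr x := - x / (x - 1) ^+ 2.

Lemma logjet_Xn_sub1 x n : x ^+ n != 1 ->
  logjet x ('X^n - 1) (x ^+ n - 1) (n%:R * x ^+ n / (x ^+ n - 1))
    (n%:R ^+ 2 * logsqr (x ^+ n)).
Proof.
rewrite -subr_eq0 => nz; rewrite /logjet /logsqr.
have -> : qderiv ('X^n - 1) = 'X^n *+ n :> {poly K}.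
  by rewrite -qderivXn !qderivE derivB derivC subr0.
rewrite qderivMn qderivXn !hornerMn hornerXn hornerD hornerN hornerC hornerXn.
by split=> //; field.
Qed.

Lemma logjet_qint x n : x != 1 -> x ^+ n != 1 ->
  logjet x (qint K n) ((x ^+ n - 1) / (x - 1))
    (n%:R * x ^+ n / (x ^+ n - 1) - x / (x - 1))
    (n%:R ^+ 2 * logsqr (x ^+ n) - logsqr x).
Proof.
move=> x1 xn1; have := @logjet_Xn_sub1 x 1.
rewrite !expr1 expr1n !mul1r => /(_ x1) j1.
apply: logjet_div j1; first by rewrite subr_eq0.
by rewrite qint_mulX1; apply: logjet_Xn_sub1.
Qed.

Variables (e : nat) (w : K).
Hypothesis w_prim : e.-primitive_root w.

Let e_gt0 : (0 < e)%N := prim_order_gt0 w_prim.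

Let e_neq0 : e%:R != 0 :> K.
Proof. by rewrite pnatr_eq0 -lt0n. Qed.

Let w_expe : w ^+ e = 1 := prim_expr_order w_prim.

Let w_neq0 : w != 0.
Proof. by rewrite (prim_root_eq0 w_prim) -lt0n. Qed.

Lemma prim_root_expr_neq1 k r : (0 < r < e)%N -> w ^+ (e * k + r) != 1.
Proof.
move=> /andP[r_gt0 lt_re]; rewrite -(prim_order_dvd w_prim) /dvdn.
by rewrite mulnC modnMDl modn_small // -lt0n.
Qed.

Lemma prim_root_exprD k r : w ^+ (e * k + r) = w ^+ r.
Proof. by rewrite exprD exprM w_expe expr1n mul1r. Qed.

Let wr_neq1 r : (0 < r < e)%N -> w ^+ r != 1.
Proof. by move/(prim_root_expr_neq1 0); rewrite muln0. Qed.

Let w_neq1 r : (0 < r < e)%N -> w != 1.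
Proof. by move=> ?; rewrite -[w]expr1 wr_neq1 //; lia. Qed.

Lemma qint_prim_root : qint K e = \prod_(1 <= r < e) ('X - (w ^+ r)%:P).
Proof.
apply: (mulIf (polyX_subr1_neq0 K)); rewrite qint_mulX1.
by rewrite -(factor_Xn_sub_1 w_prim) big_ltn // expr0 polyC1 mulrC.
Qed.

Lemma logjet_qint_prim_root :
  [/\ \sum_(1 <= r < e) (1 - w ^+ r)^-1 = (e%:R - 1) / 2
    & \sum_(1 <= r < e) logsqr (w ^+ r) = (e%:R ^+ 2 - 1) / 12].
Proof.
(* The jet of [e] at q = 1, from its expansion as a sum of powers; [j2] is the same jet, from the
   factorization. *)
have := @logjet_qint_comp 1 1 e (expr1n _ _).
rewrite expr1 comp_polyXr qint_prim_root expr1n !mul1r => j1.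
have j2 : logjet 1 (\prod_(1 <= r < e) ('X - (w ^+ r)%:P))
    (\prod_(1 <= r < e) (1 - w ^+ r)) (\sum_(1 <= r < e) (1 - w ^+ r)^-1)
    (\sum_(1 <= r < e) logsqr (w ^+ r)).
  rewrite !big_nat; apply: logjet_prod => r /wr_neq1; rewrite eq_sym.
  by move=> /logjet_XsubC; rewrite /logsqr !mul1r -[w ^+ r - 1]opprB sqrrN.
by have [_ -> ->] := logjet_uniq e_neq0 j1 j2.
Qed.

Lemma sum_prim_root_div :
  \sum_(1 <= r < e) w ^+ r / (w ^+ r - 1) = (e%:R - 1) / 2.
Proof.
have [sum1 _] := logjet_qint_prim_root.
transitivity (\sum_(1 <= r < e) (1 - (1 - w ^+ r)^-1)).
  apply: eq_big_nat => r /wr_neq1; rewrite -subr_eq0 => nz.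
  by rewrite -[1 - w ^+ r]opprB; field.
by rewrite sumrB sum1 sumr_const_nat natrB //; field.
Qed.

Lemma sum_logsqr : \sum_(1 <= r < e) logsqr (w ^+ r) = (e%:R ^+ 2 - 1) / 12.
Proof. by case: logjet_qint_prim_root. Qed.

(* The substitution r -> e - r fixes logsqr (w ^+ r). *)
Lemma sum_mul_logsqr :
  \sum_(1 <= r < e) r%:R * logsqr (w ^+ r) = e%:R * (e%:R ^+ 2 - 1) / 24.
Proof.
set S := LHS; suff : S = e%:R * ((e%:R ^+ 2 - 1) / 12) - S.
  have half (x y : K) : x = y - x -> x = y / 2.
    by move=> xE; rewrite -(subrK x y) -xE; field.
  by move=> /half ->; field.
rewrite -sum_logsqr mulr_sumr -sumrB /S big_nat_rev; apply: eq_big_nat => r rP.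
have -> : (1 + e - r.+1 = e - r)%N by lia.
have le_re : (r <= e)%N by lia.
have wE : w ^+ (e - r) = (w ^+ r)^-1.
  by apply: (mulIf (expf_neq0 r w_neq0));
    rewrite -exprD subnK // w_expe mulVf // expf_neq0.
rewrite -mulrBl natrB // wE; congr (_ * _); rewrite /logsqr.
move: (wr_neq1 rP) (expf_neq0 r w_neq0); rewrite -subr_eq0 => nz1 nz.
by field; rewrite nz nz1 /= mulN1r subr_eq0 eq_sym -subr_eq0.
Qed.

(* qfact with the factor [e] removed from each [m] with e | m, so that it does
   not vanish at w. *)
Definition ufact n : {poly K} :=
  \prod_(1 <= i < n.+1)
    (if (e %| i)%N then qint K (i %/ e) \Po 'X^e else qint K i).

Lemma ufactS n : ufact n.+1 = ufact n *
  (if (e %| n.+1)%N then qint K (n.+1 %/ e) \Po 'X^e else qint K n.+1).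
Proof. by rewrite /ufact big_nat_recr. Qed.

Lemma qfact_ufact n : qfact K n = ufact n * qint K e ^+ (n %/ e).
Proof.
elim: n => [|n IHn].
  by rewrite qfact0 /ufact big_nil div0n expr0 mulr1.
rewrite qfactS IHn ufactS divnS //; case: ifPn => [e_n|_]; last first.
  by rewrite add0n mulrAC.
by rewrite -{1}(divnK e_n) mulnC qint_mul divnS // e_n add1n exprS; ring.
Qed.

(** The second hypothesis says that the residues of k and n - k modulo e add up without carry; the
    powers of [e] removed in [ufact] then cancel. *)
Lemma qbinom_ufact n k : (k <= n)%N -> (k %/ e + (n - k) %/ e = n %/ e)%N ->
  qbinom K n k * (ufact k * ufact (n - k)) = ufact n.
Proof.
move=> le_kn kn; have nz : qint K e ^+ (n %/ e) != 0.
  by rewrite expf_neq0 // monic_neq0 // qint_monic.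
apply: (mulIf nz); rewrite -qfact_ufact -(qbinomE K le_kn) 2!qfact_ufact.
by rewrite -kn exprD; ring.
Qed.

(** The common value at [w] of every block [e k + 1] ... [e k + e - 1]. Only its nonvanishing
    matters, as it cancels in q-binomials. *)
Local Notation V := (qfact K e.-1).[w].

Lemma horner_qint_prim_root k r :
  (0 < r < e)%N -> (qint K (e * k + r)).[w] = (w ^+ r - 1) / (w - 1).
Proof.
move=> rP; have [-> _ _] := logjet_qint (w_neq1 rP) (prim_root_expr_neq1 k rP).
by rewrite prim_root_exprD.
Qed.

Lemma horner_qint_neq0 r : (0 < r < e)%N -> (qint K r).[w] != 0.
Proof.
move=> rP; have := horner_qint_prim_root 0 rP; rewrite muln0 add0n => ->.
by rewrite mulf_neq0 ?invr_eq0 ?subr_eq0 ?wr_neq1 ?(w_neq1 rP).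
Qed.

Lemma horner_qfact_neq0 r : (r < e)%N -> (qfact K r).[w] != 0.
Proof.
elim: r => [|r IHr] lt_re; first by rewrite qfact0 hornerC oner_neq0.
by rewrite qfactS hornerM mulf_neq0 ?IHr ?horner_qint_neq0 //; lia.
Qed.

Let V_neq0 : V != 0.
Proof. by rewrite horner_qfact_neq0 // prednK. Qed.

Lemma ufactD k r : (r < e)%N ->
  ufact (e * k + r) = ufact (e * k) * \prod_(1 <= i < r.+1) qint K (e * k + i).
Proof.
elim: r => [|r IHr] lt_re; first by rewrite big_nil addn0 mulr1.
rewrite addnS ufactS IHr ?(ltnW lt_re) // [in RHS]big_nat_recr //= mulrA addnS.
by case: ifPn => //; rewrite /dvdn -addnS mulnC modnMDl modn_small.
Qed.

Lemma ufact_block k : ufact (e * k.+1) = ufact (e * k) *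
  ((\prod_(1 <= r < e) qint K (e * k + r)) * (qint K k.+1 \Po 'X^e)).
Proof.
have -> : (e * k.+1 = (e * k + e.-1).+1)%N by rewrite mulnS; lia.
rewrite ufactS ufactD ?prednK // -addnS prednK //.
by rewrite -mulnSr dvdn_mulr // mulKn // mulrA.
Qed.

(** Since w^(e k + r) = w^r, moving from block 0 to block k only replaces the weights r and r^2 by e
    k + r and (e k + r)^2. The part free of k is kept as unknown constants, which cancel in
    q-binomials; the rest reduces to the three sums over roots of unity computed above. *)
Lemma logjet_block : exists l0 s0 : K, forall k,
  logjet w (\prod_(1 <= r < e) qint K (e * k + r)) V
    (l0 + e%:R * k%:R * (e%:R - 1) / 2)
    (s0 + e%:R ^+ 2 * k%:R * (k%:R + 1) * (e%:R ^+ 2 - 1) / 12).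
Proof.
exists (\sum_(1 <= r < e) (r%:R * w ^+ r / (w ^+ r - 1) - w / (w - 1))).
exists (\sum_(1 <= r < e) (r%:R ^+ 2 * logsqr (w ^+ r) - logsqr w)) => k.
have -> : V = \prod_(1 <= r < e) ((w ^+ (e * k + r) - 1) / (w - 1)).
  rewrite /qfact prednK // horner_prod; apply: eq_big_nat => r rP.
  rewrite prim_root_exprD -(horner_qint_prim_root 0 rP).
  by rewrite muln0.
have -> : e%:R * k%:R * (e%:R - 1) / 2 =
    \sum_(1 <= r < e) (e * k)%:R * (w ^+ r / (w ^+ r - 1)).
  by rewrite -mulr_sumr sum_prim_root_div natrM; field.
have -> : e%:R ^+ 2 * k%:R * (k%:R + 1) * (e%:R ^+ 2 - 1) / 12 =
    \sum_(1 <= r < e) ((e * k)%:R ^+ 2 * logsqr (w ^+ r)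
      + (e * k)%:R * 2 * (r%:R * logsqr (w ^+ r))).
  by rewrite big_split -!mulr_sumr sum_logsqr sum_mul_logsqr natrM /=; field.
rewrite -!big_split !big_nat /=.
apply: logjet_prod => r rP.
have := logjet_qint (w_neq1 rP) (prim_root_expr_neq1 k rP).
rewrite prim_root_exprD natrD; congr logjet; ring.
Qed.

(** Adds up, for j < n, the jets of block j and of [j + 1] at q^e. The second component collects the
    sums of (j + 1)^2 - 1 and of j (j + 1); the unknown constants enter linearly in n. *)
Lemma logjet_ufact : exists l0 s0 : K, forall n,
  logjet w (ufact (e * n)) (n`!%:R * V ^+ n)
    (n%:R * l0 + e%:R ^+ 2 * (n%:R * (n%:R - 1)) / 4)
    (n%:R * s0 + e%:R ^+ 2 * (n%:R * (n%:R + 1) * (2 * n%:R + 1) / 6 - n%:R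
       + (e%:R ^+ 2 - 1) * (n%:R ^+ 3 - n%:R) / 3) / 12).
Proof.
have [l0 [s0 block]] := logjet_block; exists l0, s0.
elim=> [|n IHn].
  rewrite muln0 /ufact big_nil; have := logjet1 w; 
  by congr logjet; rewrite ?fact0 ?expr0; field.
rewrite ufact_block; have := logjetM (block n) (logjet_qint_comp n.+1 w_expe).
move/(logjetM IHn); rewrite factS [V ^+ n.+1]exprS natrM -[n.+1%:R]natr1.
by congr logjet; field.
Qed.

(** The constants [l0] and [s0] have coefficient (m + k) - m - k = 0 in the quotient of the
    [ufact]s, and the powers of [V] cancel likewise. *)
Lemma logjet_qbinom m k :
  logjet w (qbinom K (e * (m + k)) (e * k)) 'C(m + k, k)%:R
    (e%:R ^+ 2 * k%:R * m%:R / 2)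
    (e%:R ^+ 2 * k%:R * m%:R * (e%:R ^+ 2 * (m%:R + k%:R) + 1) / 12).
Proof.
have [l0 [s0 ufJ]] := logjet_ufact.
have facts (i : nat) : i`!%:R != 0 :> K by rewrite pnatr_eq0 -lt0n fact_gt0.
have nz : (k`!%:R * V ^+ k) * (m`!%:R * V ^+ m) != 0.
  by rewrite !mulf_neq0 ?expf_neq0 ?facts.
have ubin : qbinom K (e * (m + k)) (e * k) * (ufact (e * k) * ufact (e * m))
    = ufact (e * (m + k)).
  have := @qbinom_ufact (e * (m + k)) (e * k).
  rewrite -mulnBr addnK !mulKn // leq_pmul2l // leq_addl addnC.
  by apply.
have := ufJ (m + k)%N; rewrite -ubin => jmk.
have := logjet_div nz jmk (logjetM (ufJ k) (ufJ m)).
rewrite -(bin_fact (leq_addl m k)) addnK !natrM natrD exprD.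
have Vn (i : nat) : V ^+ i != 0 by rewrite expf_neq0.
congr logjet; field; by rewrite ?facts ?Vn.
Qed.

Lemma horner_ufact n r : (r < e)%N ->
  (ufact (e * n + r)).[w] = n`!%:R * V ^+ n * (qfact K r).[w].
Proof.
move=> lt_re; rewrite ufactD // hornerM; congr (_ * _).
  by have [l0 [s0 /(_ n) []]] := logjet_ufact.
rewrite /qfact !horner_prod; apply: eq_big_nat => i iP.
rewrite horner_qint_prim_root; last by lia.
by rewrite -(horner_qint_prim_root 0) ?muln0 //; lia.
Qed.

(** The q-Lucas theorem, with denominators cleared, when the residues r and s add up without
    carry. *)
Lemma horner_qbinom_Lucas m k r s : (r + s < e)%N ->
  (qbinom K (e * (m + k) + (r + s)) (e * k + r)).[w]
    * ((qfact K r).[w] * (qfact K s).[w])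
  = 'C(m + k, k)%:R * (qfact K (r + s)).[w].
Proof.
move=> lt_rse; have lt_re : (r < e)%N by lia.
have lt_se : (s < e)%N by lia.
have divE i j : (j < e)%N -> ((e * i + j) %/ e = i)%N.
  by move=> lt_je; rewrite mulnC divnMDl // divn_small // addn0.
have := @qbinom_ufact (e * (m + k) + (r + s)) (e * k + r).
have -> : (e * (m + k) + (r + s) - (e * k + r) = e * m + s)%N by lia.
rewrite !divE // => /(_ ltac:(lia) (addnC k m)) /(congr1 (horner^~ w)).
rewrite !hornerM !horner_ufact // -(bin_fact (leq_addl m k)) addnK.
rewrite exprD !natrM => E.
have nz : k`!%:R * m`!%:R * V ^+ m * V ^+ k != 0.
  by rewrite !mulf_neq0 ?expf_neq0 // pnatr_eq0 -lt0n fact_gt0.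
apply: (mulIf nz).
by apply: etrans (etrans E _); ring.
Qed.

(** At [w] one has [e - r] = - w^(-r) [r], and squaring removes the signs. Equivalently, the square
    of [e - 1 choose r - 1] at [w] is w^(- r (r - 1)). *)
Lemma sqr_horner_qfact_prim_root r : (0 < r <= e)%N ->
  ((qfact K r.-1).[w] * (qfact K (e - r)).[w]) ^+ 2 = V ^+ 2 * w ^+ (r * r.-1).
Proof.
elim: r => // -[|r] IHr rP.
  by rewrite muln0 expr0 mulr1 qfact0 hornerC mul1r subn1.
have rP' : (0 < r.+1 < e)%N by lia.
have sP : (0 < e - r.+1 < e)%N by lia.
have {IHr} := IHr ltac:(lia).
have -> : (e - r.+1 = (e - r.+2).+1)%N by lia.
have -> : (r.+2 * r.+2.-1 = r.+1 * r.+1.-1 + r.+1 * 2)%N by rewrite /=; nia.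
rewrite exprD mulrA => <-; rewrite !qfactS !hornerM exprM.
have -> : (e - r.+2).+1 = (e - r.+1)%N by lia.
have := horner_qint_prim_root 0 rP'; have := horner_qint_prim_root 0 sP.
rewrite muln0 !add0n => -> ->.
have -> : w ^+ (e - r.+1) = (w ^+ r.+1)^-1.
  by apply: (mulIf (expf_neq0 r.+1 w_neq0));
    rewrite -exprD subnK ?w_expe ?mulVf ?expf_neq0 //; lia.
move: (w_neq1 rP') (expf_neq0 r.+1 w_neq0); rewrite -subr_eq0 => nz1 nz /=.
by field; rewrite nz nz1.
Qed.

Lemma qbinom_absorb n k : (k <= n)%N ->
  qbinom K n.+1 k.+1 * qint K k.+1 = qint K n.+1 * qbinom K n k.
Proof.
move=> le_kn; have nz : qfact K k * qfact K (n - k) != 0.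
  by rewrite mulf_neq0 // monic_neq0 // qfact_monic.
apply: (mulIf nz); rewrite -[RHS]mulrA qbinomE // mulrC [RHS]mulrC -qfactS.
by rewrite -(@qbinomE K n.+1 k.+1) // subSS qfactS; ring.
Qed.

(** Absorption isolates the simple zero: the q-binomial times [e k + r] is [e n] times [c], where
    neither [e k + r] nor [c] vanishes at [w], and theta [e n] is e n / (w - 1) there. The factor
    w^(r^2) is the value of q^f in the corresponding term of a_n; with c^2 it leaves w^r, hence
    [logsqr]. *)
Lemma horner_qbinom_ndvd n k r : (k < n)%N -> (0 < r < e)%N ->
  (qbinom K (e * n) (e * k + r)).[w] = 0
  /\ (qderiv (qbinom K (e * n) (e * k + r))).[w] ^+ 2 * w ^+ (r ^ 2)
     = - ((e * n)%:R ^+ 2 * 'C(n.-1, k)%:R ^+ 2 * logsqr (w ^+ r)).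
Proof.
move=> lt_kn rP; set b := qbinom _ _ _.
have [m nE] : exists m, n = (m + k).+1 by exists (n - k.+1)%N; lia.
set c := qbinom K (e * n).-1 (e * k + r.-1).
have bcE : b * qint K (e * k + r) = qint K (e * n) * c.
  have := @qbinom_absorb (e * n).-1 (e * k + r.-1).
  by rewrite -addnS !prednK //; [apply; nia | lia | nia].
have nz : w - 1 != 0 by rewrite subr_eq0 (w_neq1 rP).
have nzr : w ^+ r - 1 != 0 by rewrite subr_eq0 wr_neq1.
have wen : w ^+ (e * n) = 1 by rewrite exprM w_expe expr1n.
have qX1 := qint_mulX1 K (e * n).
have qn0 : (qint K (e * n)).[w] = 0.
  apply: (mulIf nz); have /(congr1 (horner^~ w)) := qX1.
  by rewrite hornerM !hornerE wen subrr => ->.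
have dqn : (qderiv (qint K (e * n))).[w] * (w - 1) = (e * n)%:R.
  have /(congr1 (fun F => (qderiv F).[w])) := qX1.
  rewrite qderivM hornerD !hornerM qn0 mul0r addr0 hornerXsubC => ->.
  have -> : qderiv ('X^(e * n) - 1) = qderiv 'X^(e * n) :> {poly K}.
    by rewrite !qderivE derivB derivC subr0.
  by rewrite qderivXn hornerMn hornerXn wen.
have qk := horner_qint_prim_root k rP.
have b0 : b.[w] = 0.
  have /(congr1 (horner^~ w)) := bcE.
  rewrite !hornerM qn0 mul0r qk => /eqP; rewrite mulf_eq0 mulf_eq0 invr_eq0.
  by rewrite (negPf nz) (negPf nzr) !orbF => /eqP.
split=> //.
have db : (qderiv b).[w] = (e * n)%:R * c.[w] / (w ^+ r - 1).
  have /(congr1 (fun F => (qderiv F).[w])) := bcE.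
  rewrite !qderivM !hornerD !hornerM b0 qn0 !mul0r !addr0 qk -dqn => bE.
  apply: (mulIf (mulf_neq0 nzr (invr_neq0 nz))); rewrite bE; field.
  by rewrite nz nzr.
have cE : c.[w] ^+ 2 * w ^+ (r * r.-1) = 'C(n.-1, k)%:R ^+ 2.
  (* The upper index e n - 1 of [c] has residue e - 1 = (r - 1) + (e - r), so there is no carry. *)
  have lucas := @horner_qbinom_Lucas m k r.-1 (e - r) ltac:(lia).
  have q2 := @sqr_horner_qfact_prim_root r ltac:(lia).
  have qnz : ((qfact K r.-1).[w] * (qfact K (e - r)).[w]) ^+ 2 != 0.
    by rewrite expf_neq0 // mulf_neq0 // horner_qfact_neq0; lia.
  apply: (mulIf qnz); rewrite mulrAC -exprMn.
  have -> : c = qbinom K (e * (m + k) + (r.-1 + (e - r))) (e * k + r.-1).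
    by rewrite /c; congr (qbinom K _ _); rewrite nE mulnS; lia.
  rewrite lucas nE q2 (_ : (r.-1 + (e - r) = e.-1)%N) /=; last by lia.
  by ring.
have -> : (r ^ 2 = r * r.-1 + r)%N by nia.
rewrite db exprD -cE /logsqr; field.
by rewrite nzr.
Qed.

Lemma horner_qbinomD_ndvd n k r : (0 < r < e)%N ->
  (qbinom K (e * n + (e * k + r)) (e * k + r)).[w] = 'C(n + k, k)%:R.
Proof.
move=> rP; have := @horner_qbinom_Lucas n k r 0 ltac:(lia).
rewrite qfact0 hornerC mulr1 addn0 mulnDr -addnA.
by apply: mulIf; rewrite horner_qfact_neq0; lia.
Qed.

End RootOfUnity.

(** * The Apery sums *)

Section AperyAtRootsOfUnity.
Variables (A B : int).
Hypothesis hf : forall n k : nat, 0 <= (quadf int A B).[n%:Z, k%:Z].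

Lemma horner2_quadf (R : comNzRingType) (x y : R) :
  (quadf R A B).[x, y] = y ^+ 2 + A%:~R * (x * y) + B%:~R * x ^+ 2.
Proof.
rewrite /quadf; have intrC (z : int) : z%:~R = (z%:~R)%:P%:P :> {poly {poly R}}.
  by rewrite -!(rmorph_int polyC).
by rewrite !intrC !hornerE.
Qed.

Local Notation expo n k := `|(quadf int A B).[n%:Z, k%:Z]|%N.

Lemma expoE n k : (expo n k)%:Z =
  k%:Z ^+ 2 + A * (n%:Z * k%:Z) + B * n%:Z ^+ 2.
Proof. by rewrite gez0_abs ?hf // horner2_quadf !intz. Qed.

Variable K : numFieldType.

Lemma expo_natr n k : (expo n k)%:R = (quadf K A B).[n%:R, k%:R].
Proof.
rewrite horner2_quadf -[LHS]/((expo n k)%:Z%:~R) expoE.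
by rewrite !expr2 !rmorphD !rmorphM /=.
Qed.

Lemma map_qapery n : map_poly intr (qapery A B n) =
  \sum_(k < n.+1) qbinom K n k ^+ 2 * qbinom K (n + k) k ^+ 2 * 'X^(expo n k).
Proof.
rewrite /qapery rmorph_sum /=; apply: eq_bigr => k _.
by rewrite !rmorphM !rmorphXn /= map_polyX !map_qbinom ?leq_addl // -ltnS.
Qed.

Lemma sum_residues e n (F : nat -> K) : (0 < e)%N ->
  \sum_(k < (e * n).+1) F k =
    \sum_(k < n.+1) F (e * k)%N + \sum_(k < n) \sum_(1 <= r < e) F (e * k +
      r)%N.
Proof.
move=> e_gt0; elim: n => [|n IHn].
  by rewrite muln0 !big_ord_recr !big_ord0 muln0 addr0.
rewrite [in RHS]big_ord_recr [X in _ + X]big_ord_recr /= [RHS]addrACA -IHn.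
rewrite -!(big_mkord xpredT F) (big_cat_nat (n := (e * n).+1)) //=; last first.
  by rewrite ltnS leq_pmul2l.
congr (_ + _); rewrite big_nat_recr /=; last by rewrite mulnS; lia.
rewrite addrC; congr (_ + _).
rewrite -[(e * n).+1]addn1 addnC big_addn.
rewrite (_ : (e * n.+1 - e * n = e)%N); last by rewrite mulnS; lia.
by apply: eq_bigr => i _; rewrite addnC.
Qed.

Variables (e : nat) (w : K).
Hypothesis w_prim : e.-primitive_root w.

Lemma expr_expo n k r : w ^+ expo (e * n)%N (e * k + r)%N = w ^+ (r ^ 2).
Proof.
have w_neq0 : w != 0 by rewrite (prim_root_eq0 w_prim) -lt0n (prim_order_gt0
  w_prim).
rewrite !exprnP expoE.
(* [t] is the quotient of f(e n, e k + r) - r^2 by e. It may be negative, hence the passage to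
   integer exponents. *)
set t : int := e%:Z * k%:Z ^+ 2 + 2 * k%:Z * r%:Z
  + A * (n%:Z * (e * k + r)%N%:Z) + B * n%:Z * (e * n)%N%:Z.
rewrite (_ : _ + _ = (r ^ 2)%N%:Z + e%:Z * t).
  by rewrite expfzDr // -exprz_exp -(exprnP w e) (prim_expr_order w_prim)
    exp1rz mulr1.
rewrite /t !PoszD !PoszM; ring.
Qed.

Lemma expo_mul n k : expo (e * n)%N (e * k)%N = (e ^ 2 * expo n k)%N.
Proof.
apply/eqP; rewrite -eqz_nat -mulnn !PoszM !expoE !PoszM; apply/eqP; ring.
Qed.

Let term n k :=
  qbinom K n k ^+ 2 * qbinom K (n + k) k ^+ 2 * 'X^(expo n k).

Let bin2 n k : K := ('C(n, k) ^ 2 * 'C(n + k, n) ^ 2)%:R.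

Let P1 n k : K := 2 * n%:R * k%:R - k%:R ^+ 2 + (quadf K A B).[n%:R, k%:R].

(** The two squared q-binomials contribute k (n - k) + k n = 2 n k - k^2 to the first logarithmic
    derivative, up to e^2. The monomial has value 1 at [w] and contributes e^2 f(n, k) to the first
    component only. *)
Lemma logjet_term n k : (k <= n)%N ->
  logjet w (term (e * n) (e * k)) (bin2 n k) (e%:R ^+ 2 * P1 n k)
    (e%:R ^+ 2 * (2 * e%:R ^+ 2 * n%:R ^+ 2 * k%:R +
      2 * n%:R * k%:R - k%:R ^+ 2) / 6).
Proof.
move=> le_kn; have [m nE] : exists m, n = (m + k)%N by exists (n - k)%N; lia.
have j1 := logjetX 2 (logjet_qbinom w_prim m k).
have j2 := logjetX 2 (logjet_qbinom w_prim n k).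
have := logjetM (logjetM j1 j2) (logjetXn w (expo (e * n)%N (e * k)%N)).
have := expr_expo n k 0; rewrite addn0 exp0n // expr0 => ->.
rewrite expo_natr /term -mulnDr -nE -expo_natr expo_mul natrM expo_natr;
  congr logjet.
- by rewrite /bin2 -(bin_sub (leq_addr k n)) addKn natrM !natrX mulr1.
- by rewrite /P1 natrX nE natrD; field.
- by rewrite nE natrD; field.
Qed.

Lemma horner_term_ndvd n k r : (k < n)%N -> (0 < r < e)%N ->
  [/\ (term (e * n) (e * k + r)).[w] = 0,
      (qderiv (term (e * n) (e * k + r))).[w] = 0
    & (qderiv (qderiv (term (e * n) (e * k + r)))).[w]
      = - (2 * e%:R ^+ 2 * (n%:R - k%:R) ^+ 2 * bin2 n k * logsqr (w ^+ r))].
Proof.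
move=> lt_kn rP; have [b0 b1] := horner_qbinom_ndvd w_prim lt_kn rP.
have c0 := horner_qbinomD_ndvd w_prim n k rP.
have x0 := expr_expo n k r.
rewrite /term; move: c0 x0 b0 b1; set b := qbinom K (e * n) _.
set c := qbinom K (e * n + _) _ => c0 x0 b0 b1.
rewrite -mulrA !expr2; set D := c * c * _.
have D0 : D.[w] = 'C(n + k, k)%:R ^+ 2 * w ^+ (r ^ 2).
  by rewrite /D !hornerM hornerXn x0 c0 expr2.
(* Only the value of [D] is needed: its derivatives always come multiplied by b(w) = 0. *)
clearbody D; rewrite !(qderivM, qderivD) !(hornerM, hornerD) b0 D0.
split; [by ring | by ring |].
(* From (n - k) C(n, k) = n C(n - 1, k), which brings all terms to the common weight [bin2]. *)
have bin2E : bin2 n k * (n%:R - k%:R) ^+ 2 =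
    'C(n + k, k)%:R ^+ 2 * (n%:R ^+ 2 * 'C(n.-1, k)%:R ^+ 2).
  rewrite /bin2 -(bin_sub (leq_addr k n)) addKn natrM !natrX.
  rewrite -natrB 1?ltnW // -[n%:R ^+ 2 * _]exprMn -natrM mul_bin_down natrM.
  by ring.
rewrite -[RHS]mulNr -[in RHS]mulrA.
transitivity (2 * ((qderiv b).[w] ^+ 2 * w ^+ (r ^ 2)) * 'C(n + k, k)%:R ^+ 2).
  by ring.
rewrite b1 natrM.
transitivity (- (2 * e%:R ^+ 2 * (bin2 n k * (n%:R - k%:R) ^+ 2)
  * logsqr (w ^+ r))); last by ring.
by rewrite bin2E; ring.
Qed.

Let a n : {poly K} := map_poly intr (qapery A B n).

Lemma logjet_apery n :
  [/\ (a (e * n)).[w] = \sum_(k < n.+1) bin2 n k,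
      (qderiv (a (e * n))).[w] = e%:R ^+ 2 * \sum_(k < n.+1) bin2 n k * P1 n k
    & (qderiv (qderiv (a (e * n)))).[w] = \sum_(k < n.+1) bin2 n k *
        (e%:R ^+ 4 * (P1 n k ^+ 2 +
          n%:R ^+ 2 * k%:R / 3 - (n%:R - k%:R) ^+ 2 / 6)
         + e%:R ^+ 2 * (n%:R ^+ 2 / 6))].
Proof.
have aE : a (e * n) = \sum_(k < (e * n).+1) term (e * n) k := map_qapery _.
have e_gt0 := prim_order_gt0 w_prim.
rewrite aE !qderiv_sum !horner_sum.
rewrite (sum_residues n (fun k => (term (e * n) k).[w])) //.
rewrite (sum_residues n (fun k => (qderiv (term (e * n) k)).[w])) //.
rewrite (sum_residues n (fun k => (qderiv (qderiv (term (e * n) k))).[w])) //.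
split.
- rewrite [X in _ + X]big1 ?addr0 => [|k _].
    by apply: eq_bigr => k _; case: (logjet_term (leq_ord k)).
  rewrite big_nat big1 // => r rP.
  by case: (horner_term_ndvd (ltn_ord k) rP).
- rewrite [X in _ + X]big1 ?addr0 => [|k _].
    rewrite mulr_sumr; apply: eq_bigr => k _.
    by case: (logjet_term (leq_ord k)) => _ -> _; ring.
  rewrite big_nat big1 // => r rP.
  by case: (horner_term_ndvd (ltn_ord k) rP).
(* The sum of [logsqr] over r gives (e^2 - 1) / 12. The index k = n may be added because of the
   factor (n - k)^2, so that this sum merges with the one over multiples of e; the e^2 parts then
   combine by (2 n k - k^2) + (n - k)^2 = n^2. *)
have -> : \sum_(k < n) \sum_(1 <= r < e)
    (qderiv (qderiv (term (e * n) (e * k + r)))).[w] =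
  \sum_(k < n.+1) - (e%:R ^+ 2 * (e%:R ^+ 2 - 1) * (n%:R - k%:R) ^+ 2
                     * bin2 n k / 6).
  rewrite [RHS]big_ord_recr /= subrr !(mulr0, mul0r, expr0n) oppr0 addr0.
  apply: eq_bigr => k _.
  transitivity (- (2 * e%:R ^+ 2 * (n%:R - k%:R) ^+ 2 * bin2 n k
                   * \sum_(1 <= r < e) logsqr (w ^+ r))).
    rewrite mulr_sumr -sumrN; apply: eq_big_nat => r rP.
    by case: (horner_term_ndvd (ltn_ord k) rP).
  by rewrite (sum_logsqr w_prim); field.
rewrite -big_split; apply: eq_bigr => k _ /=.
case: (logjet_term (leq_ord k)) => _ _ ->; by field.
Qed.

End AperyAtRootsOfUnity.

(** * Ordinary derivatives of a_n at roots of unity *)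

Section AperyDerivatives.
Variables (A B : int) (K : numFieldType) (e : nat) (w : K).
Hypothesis hf : forall n k : nat, 0 <= (quadf int A B).[n%:Z, k%:Z].
Hypothesis w_prim : e.-primitive_root w.

Let a n : {poly K} := map_poly intr (qapery A B n).
Let f : {poly {poly K}} := quadf K A B.
Let P1 : {poly {poly K}} := 'X * 'Y *+ 2 - 'Y ^+ 2 + f.
Let P2 : {poly {poly K}} :=
  P1 ^+ 2 + (3^-1)%:P *: ('X ^+ 2 * 'Y) - (6^-1)%:P *: ('X - 'Y) ^+ 2.
Let P3 : {poly {poly K}} :=
  (6^-1)%:P *: 'X ^+ 2 - 'X * 'Y *+ 2 + 'Y ^+ 2 - f.

Lemma horner_derivs (p : {poly K}) :
  w * p^`().[w] = (qderiv p).[w]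
  /\ w ^+ 2 * p^`(2).[w] = (qderiv (qderiv p)).[w] - (qderiv p).[w].
Proof.
rewrite derivnS derivn1 !qderivE derivM derivX mul1r.
by rewrite !(hornerM, hornerD, hornerX); split=> //; ring.
Qed.

Lemma apery_at_root n :
  [/\ (a (e * n)).[w] = (a n).[1],
      w * (a (e * n))^`().[w] = e%:R ^+ 2 * apery_wt P1 n
    & w ^+ 2 * (a (e * n))^`(2).[w] = e%:R ^+ 4 * apery_wt P2 n
                                      + e%:R ^+ 2 * apery_wt P3 n].
Proof.
have [a0 a1 a2] := logjet_apery hf w_prim n.
(* The case e = 1, w = 1 of the same formula evaluates a_n(1). *)
have prim1 : 1.-primitive_root (1 : K).
  apply/andP; split=> //; apply/forallP => i.
  by rewrite ord1 unity_rootE expr1n !eqxx.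
have [b0 _ _] := logjet_apery hf prim1 n.
have [-> ->] := horner_derivs (a (e * n)).
have hornE := (hornerD, hornerN, hornerZ, hornerMn, horner_exp, hornerM,
  hornerX, hornerC).
have P1E (k : nat) : P1.[n%:R, k%:R] =
    2 * n%:R * k%:R - k%:R ^+ 2 + (quadf K A B).[n%:R, k%:R].
  rewrite /P1 /f; move: (quadf K A B) => g.
  by rewrite !hornE; ring.
rewrite a0 a1 a2; split.
- by rewrite -[n in RHS]mul1n b0.
- by congr (_ * _); apply: eq_bigr => k _; rewrite P1E.
rewrite !mulr_sumr -big_split -sumrB; apply: eq_bigr => k _ /=.
(* q^2 F'' = theta^2 F - theta F, and subtracting theta a_n turns the e^2 weight x^2/6 into x^2/6 -
   P1, which is [P3]. *)
have -> : P3.[n%:R, k%:R] = n%:R ^+ 2 / 6 - P1.[n%:R, k%:R].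
  rewrite /P3 /P1 /f; move: (quadf K A B) => g.
  by rewrite !hornE; ring.
have -> : P2.[n%:R, k%:R] = P1.[n%:R, k%:R] ^+ 2 + n%:R ^+ 2 * k%:R / 3
    - (n%:R - k%:R) ^+ 2 / 6.
  rewrite /P2; move: P1 => Q.
  by rewrite !hornE; field.
by rewrite P1E; field.
Qed.

End AperyDerivatives.

(** * Moebius inversion and digits *)

Lemma dvdn_div_gt0 d n : (0 < n)%N -> (d %| n)%N -> (0 < n %/ d)%N.
Proof.
by move=> n_gt0 d_n; rewrite divn_gt0 ?(dvdn_gt0 n_gt0 d_n) // dvdn_leq.
Qed.

Lemma moebius_prime_mul p m : prime p -> (0 < m)%N ->
  moebius (p * m) = if (p %| m)%N then 0 else - moebius m.
Proof.
move=> p_pr m_gt0; have p_gt0 := prime_gt0 p_pr.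
rewrite /moebius muln_gt0 p_gt0 m_gt0 /=; have [p_m|p_ndv] := boolP (p %| m)%N.
  rewrite ifN //; apply/allPn; exists p.
    by rewrite mem_primes p_pr muln_gt0 p_gt0 m_gt0 dvdn_mulr.
  have : (0 < logn p m)%N by rewrite logn_gt0 mem_primes p_pr m_gt0.
  by rewrite lognM // (logn_prime _ p_pr) eqxx; lia.
have pm : perm_eq (primes (p * m)) (p :: primes m).
  apply: uniq_perm; rewrite ?primes_uniq //= ?primes_uniq ?andbT.
    by rewrite mem_primes p_pr m_gt0.
  by move=> q; rewrite primesM // primes_prime // !inE.
rewrite (perm_all _ pm) (perm_size pm) /=.
rewrite lognM // (logn_prime _ p_pr) eqxx lognE p_pr m_gt0 (negPf p_ndv) /=.
have -> : all (fun q => logn q (p * m) == 1%N) (primes m) =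
          all (fun q => logn q m == 1%N) (primes m).
  apply: eq_in_all => q; rewrite mem_primes => /and3P[q_pr _ q_m].
  rewrite lognM // (logn_prime _ p_pr); case: (q =P p) => [qp|//].
  by rewrite -qp q_m in p_ndv.
by case: ifP => _; rewrite ?oppr0 // exprS mulN1r.
Qed.

Lemma perm_divisors_dvd d n : (0 < n)%N -> (d %| n)%N ->
  perm_eq [seq e <- divisors n | (e %| d)%N] (divisors d).
Proof.
move=> n_gt0 d_n; have d_gt0 := dvdn_gt0 n_gt0 d_n.
apply: uniq_perm; rewrite ?filter_uniq ?divisors_uniq // => e.
rewrite mem_filter -!dvdn_divisors //; apply: andb_idr => e_d.
exact: dvdn_trans e_d d_n.
Qed.

Lemma perm_divisors_mul d n : (0 < n)%N -> (d %| n)%N ->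
  perm_eq [seq e <- divisors n | (d %| e)%N]
          [seq (d * e)%N | e <- divisors (n %/ d)].
Proof.
move=> n_gt0 d_n; have d_gt0 := dvdn_gt0 n_gt0 d_n.
have nd_gt0 := dvdn_div_gt0 n_gt0 d_n.
apply: uniq_perm; rewrite ?filter_uniq ?divisors_uniq //.
  by rewrite map_inj_uniq ?divisors_uniq // => x y /eqP;
    rewrite eqn_pmul2l // => /eqP.
move=> e; rewrite mem_filter -dvdn_divisors //.
apply/andP/mapP => [[/dvdnP[c ->] c_n]|[c]].
  exists c; last by rewrite mulnC.
  by rewrite -dvdn_divisors // dvdn_divRL.
by rewrite -dvdn_divisors // dvdn_divRL // mulnC => c_n ->; split;
  first exact: dvdn_mulr.
Qed.

(* d -> p * d exchanges the divisors prime to p with the multiples of p that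
   p^2 does not divide, and changes the sign of moebius. *)
Lemma sum_moebius n : (0 < n)%N ->
  \sum_(d <- divisors n) moebius d = (n == 1%N)%:R.
Proof.
move=> n_gt0; case: eqVneq => [->|n_neq1].
  by rewrite big_cons big_nil addr0.
have p_pr : prime (pdiv n) by rewrite pdiv_prime // ltn_neqAle eq_sym n_neq1.
have p_n := pdiv_dvd n; move: (pdiv n) p_pr p_n => p p_pr p_n.
have p_gt0 := prime_gt0 p_pr.
have np_gt0 := dvdn_div_gt0 n_gt0 p_n.
rewrite (bigID (fun d => (p %| d)%N)) /= -big_filter.
rewrite (perm_big _ (perm_divisors_mul n_gt0 p_n)) big_map.
have -> : \sum_(d <- divisors (n %/ p)) moebius (p * d) =
    - \sum_(d <- divisors (n %/ p) | ~~ (p %| d)%N) moebius d.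
  rewrite -sumrN [RHS]big_mkcond; apply: eq_big_seq => d.
  rewrite -dvdn_divisors // => /(dvdn_gt0 np_gt0) d_gt0.
  by rewrite moebius_prime_mul //; case: ifP.
rewrite -[X in _ + X]big_filter.
rewrite [X in _ + X](perm_big [seq d <- divisors (n %/ p) | ~~ (p %| d)%N]).
  by rewrite big_filter addNr.
apply: uniq_perm; rewrite ?filter_uniq ?divisors_uniq // => d.
rewrite !mem_filter; case: (boolP (p %| d)%N) => //= p_d.
rewrite -!dvdn_divisors //.
rewrite -{1}(divnK p_n) Gauss_dvdl // coprime_sym prime_coprime //.
Qed.

(** After exchanging the sums, the coefficient of [g e] is the sum of [moebius] over the divisors of
    n / e, which vanishes unless e = n. *)
Lemma moebius_inversion (R : comNzRingType) (g : nat -> R) n : (0 < n)%N ->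
  \sum_(d <- divisors n) \sum_(e <- divisors d) (moebius (d %/ e))%:~R * g e
  = g n.
Proof.
move=> n_gt0.
transitivity (\sum_(d <- divisors n) \sum_(e <- divisors n | (e %| d)%N)
   (moebius (d %/ e))%:~R * g e).
  apply: eq_big_seq => d; rewrite -dvdn_divisors // => d_n.
  by rewrite -[RHS]big_filter (perm_big _ (perm_divisors_dvd n_gt0 d_n)).
rewrite (exchange_big_dep xpredT) //=.
transitivity (\sum_(e <- divisors n) (e == n)%:R * g e).
  apply: eq_big_seq => e; rewrite -dvdn_divisors // => e_n.
  have e_gt0 := dvdn_gt0 n_gt0 e_n.
  have ne_gt0 := dvdn_div_gt0 n_gt0 e_n.
  rewrite -mulr_suml -big_filter (perm_big _ (perm_divisors_mul n_gt0 e_n)).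
  rewrite big_map; congr (_ * _).
  under eq_bigr do rewrite mulKn //.
  rewrite -rmorph_sum sum_moebius //= rmorph_nat; congr (_%:R).
  by rewrite -[in RHS](divnK e_n) -{2}(mul1n e) eqn_pmul2r // eq_sym.
rewrite (bigD1_seq n) ?divisors_uniq -?dvdn_divisors //= eqxx mul1r.
by rewrite big1 ?addr0 // => e /negPf ->; rewrite mul0r.
Qed.

(** * Values of G_g at roots of unity, interpolation, and expansions in base [n]_q *)

Section Interpolation.
Variables (K : numFieldType) (n : nat).
Implicit Types (g : nat -> K) (d e : nat) (F p q : {poly K}).

Lemma qint_div d : (0 < n)%N -> (d %| n)%N ->
  qint K n %/ qint K (n %/ d) = qint K d \Po 'X^(n %/ d).
Proof.
move=> n_gt0 d_n; rewrite -{1}(divnK d_n) qint_mul.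
exact/Pdiv.IdomainMonic.mulKp/qint_monic/dvdn_div_gt0.
Qed.

Lemma horner_qint (x : K) k : (qint K k).[x] * (x - 1) = x ^+ k - 1.
Proof.
have /(congr1 (horner^~ x)) := qint_mulX1 K k.
by rewrite hornerM !hornerD !hornerN !hornerC hornerX hornerXn.
Qed.

(** The quotient is [d] at q^(n/d), and w^(n/d) is a d-th root of unity: [d] takes the value d at 1
    and vanishes at the others. *)
Lemma horner_qint_div d e (w : K) : e.-primitive_root w -> (0 < n)%N ->
    (e %| n)%N -> (d %| n)%N ->
  (qint K n %/ qint K (n %/ d)).[w] = if (e %| n %/ d)%N then d%:R else 0.
Proof.
move=> w_prim n_gt0 e_n d_n; rewrite qint_div // horner_comp hornerXn.
rewrite (prim_order_dvd w_prim); case: (eqVneq (w ^+ _)) => [->|w_neq1].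
  rewrite qintE horner_sum; under eq_bigr do rewrite hornerXn expr1n.
  by rewrite sumr_const card_ord.
rewrite -subr_eq0 in w_neq1; apply: (mulIf w_neq1).
rewrite horner_qint -exprM divnK // mul0r; apply/eqP.
by rewrite subr_eq0 -(prim_order_dvd w_prim).
Qed.

(** The surviving d satisfy e | n/d, that is d | n/e, and the value d of the quotient cancels the
    denominator; what remains is Moebius inversion at n/e. *)
Lemma horner_Gpoly g e (w : K) : e.-primitive_root w -> (0 < n)%N ->
  (e %| n)%N -> (1 < e)%N -> (Gpoly g n).[w] = g (n %/ e)%N.
Proof.
move=> w_prim n_gt0 e_n e_gt1.
have ne_gt0 := dvdn_div_gt0 n_gt0 e_n.
rewrite -[RHS]moebius_inversion // horner_sum.
rewrite -(perm_big _ (perm_divisors_dvd n_gt0 (dvdn_div e_n))) big_filter.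
rewrite big_mkcond [RHS]big_mkcond; apply: eq_big_seq => d.
rewrite -dvdn_divisors // => d_n; have d_gt0 := dvdn_gt0 n_gt0 d_n.
rewrite hornerZ (horner_qint_div w_prim) //.
have -> : (d %| n %/ e)%N = (e %| n %/ d)%N.
  by rewrite !dvdn_divRL // mulnC.
case: (boolP (e %| n %/ d)%N) => e_nd; last by rewrite mulr0 if_same.
(* The excluded index d = n would force e | 1. *)
rewrite ifT; last first.
  by apply: contraL e_gt1 => /eqP dn; move: e_nd;
    rewrite dn divnn n_gt0 dvdn1 => /eqP ->.
by rewrite divfK // pnatr_eq0 -lt0n.
Qed.

Lemma size_Gpoly g k : (0 < n)%N ->
    (forall d, (d %| n)%N -> d != n -> (k <= n %/ d)%N) ->
  (size (Gpoly g n) <= (n - k).+1)%N.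
Proof.
move=> n_gt0 kP; rewrite /Gpoly big_seq_cond.
apply: (big_ind (fun p : {poly K} => (size p <= (n - k).+1)%N)).
- by rewrite size_poly0.
- by move=> p q sp sq; rewrite (leq_trans (size_polyD _ _)) // geq_max sp.
move=> d /andP[]; rewrite -dvdn_divisors // => d_n /(kP d d_n) le_k.
have nd_gt0 := dvdn_div_gt0 n_gt0 d_n.
apply: leq_trans (size_scale_leq _ _) _.
rewrite size_divp ?monic_neq0 ?qint_monic // !size_qint.
by have := leq_div n d; lia.
Qed.

(** The difference has degree < n - 1 and vanishes at the n - 1 distinct roots of unity other than
    1. *)
Lemma eq_poly_prim_root (z : K) p q : n.-primitive_root z ->
    (size p < n)%N -> (size q < n)%N ->
    (forall j, (0 < j < n)%N -> p.[z ^+ j] = q.[z ^+ j]) -> p = q.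
Proof.
move=> z_prim sp sq pq; apply/eqP; rewrite -subr_eq0; apply/negPn/negP => nz.
have := @max_poly_roots _ _ [seq z ^+ j | j <- iota 1 n.-1] nz.
have -> : all (root (p - q)) [seq z ^+ j | j <- iota 1 n.-1].
  apply/allP => x /mapP[j]; rewrite mem_iota => jP ->.
  by rewrite rootE hornerD hornerN pq ?subrr //; lia.
have -> : uniq [seq z ^+ j | j <- iota 1 n.-1].
  rewrite map_inj_in_uniq ?iota_uniq // => i j; rewrite !mem_iota => iP jP.
  move/eqP; rewrite (eq_prim_root_expr z_prim) !modn_small; [|lia|lia].
  by move/eqP.
rewrite size_map size_iota => /(_ isT isT); apply/negP; rewrite -leqNgt.
apply: leq_trans (size_polyD _ _) _; rewrite size_polyN geq_max.
by move: sp sq; case: (n) => // k; rewrite !ltnS => ->.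
Qed.

Lemma exists_q_expansion F : (1 < n)%N -> exists s, q_expansion n F s.
Proof.
move=> n_gt1; have [k] := ubnP (size F); elim: k F => // k IHk F leFk.
have [sF|sF] := ltnP (size F) n.
  exists [:: F]; split; first by rewrite /= sF.
  by rewrite big_ord1 expr0 mulr1.
have Nm : qint K n \is monic by rewrite qint_monic // ltnW.
have [|s [s_all sE]] := IHk (F %/ qint K n).
  rewrite size_divp ?monic_neq0 // size_qint; move: leFk sF.
  by move: (size F) => sF; lia.
exists (F %% qint K n :: s); split.
  by rewrite /= s_all andbT -[X in (_ < X)%N](size_qint K n) ltn_modp
    monic_neq0.
rewrite {1}(divp_eq F (qint K n)) sE big_ord_recl expr0 mulr1 addrC.
rewrite mulr_suml; congr (_ + _); apply: eq_bigr => i _.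
by rewrite /= -mulrA -exprSr.
Qed.

Lemma is_digit_leading (c0 c1 c2 r : {poly K}) : (1 < n)%N ->
    (size c0 < n)%N -> (size c1 < n)%N -> (size c2 < n)%N ->
  let F := c0 + c1 * qint K n + c2 * qint K n ^+ 2 + r * qint K n ^+ 3 in
  [/\ is_digit n F 0 c0, is_digit n F 1 c1 & is_digit n F 2 c2].
Proof.
move=> n_gt1 s0 s1 s2 F; have [s [s_all rE]] := exists_q_expansion r n_gt1.
have Fs : q_expansion n F [:: c0, c1, c2 & s].
  split; first by rewrite /= s0 s1 s2.
  rewrite !big_ord_recl /= /F rE expr0 mulr1 expr1 -!addrA mulr_suml.
  by do 3!congr (_ + _); apply: eq_bigr => i _; rewrite -mulrA -exprD addnC.
by split; exists [:: c0, c1, c2 & s].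
Qed.

(** Apply theta once and twice to [n] (q - 1) = q^n - 1 and solve at [x]. *)
Lemma qderiv_qint (x : K) : x ^+ n = 1 -> x != 1 ->
  [/\ (qint K n).[x] = 0, (qderiv (qint K n)).[x] = n%:R / (x - 1)
    & (qderiv (qderiv (qint K n))).[x]
      = (n%:R ^+ 2 - 2 * n%:R * x / (x - 1)) / (x - 1)].
Proof.
move=> xn1; rewrite -subr_eq0 => nz.
have dX1 : qderiv ('X - 1) = 'X :> {poly K}.
  by rewrite qderivE derivB derivX derivC subr0 mulr1.
have dX : qderiv 'X = 'X :> {poly K} by rewrite qderivE derivX mulr1.
have dXn : qderiv ('X^n - 1) = 'X^n *+ n :> {poly K}.
  by rewrite -qderivXn !qderivE derivB derivC subr0.
have X1 : ('X - 1).[x] = x - 1 by rewrite hornerXsubC.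
have N0 : (qint K n).[x] = 0.
  by apply: (mulIf nz); rewrite horner_qint xn1 subrr mul0r.
have E1 := congr1 (@qderiv K) (qint_mulX1 K n).
have E2 := congr1 (@qderiv K) E1.
move: E1 => /(congr1 (horner^~ x)); rewrite qderivM dX1 dXn hornerD !hornerM X1.
rewrite N0 mul0r addr0 hornerMn hornerXn xn1 => E1.
have N1 : (qderiv (qint K n)).[x] = n%:R / (x - 1) by rewrite -E1 mulfK.
move: E2 => /(congr1 (horner^~ x)).
rewrite qderivM dX1 dXn qderivD !qderivM dX1 dX qderivMn qderivXn.
rewrite 3!hornerD !hornerM X1 N0 N1 !hornerMn hornerXn hornerX xn1 -mulrnA
  natrM => E2.
split=> //; apply: (mulIf nz); rewrite divfK //.
rewrite -[LHS](addrK (n%:R / (x - 1) * x + (n%:R / (x - 1) * x + 0 * x))).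
by rewrite addrA E2; field.
Qed.

End Interpolation.

(** * Primitivity of omega_n *)

Section Omega.
Variable R : realType.

Lemma omegaX n j : omega R n ^+ j =
  Complex (cos (2 * pi / n%:R *+ j)) (sin (2 * pi / n%:R *+ j)).
Proof.
elim: j => [|j IHj]; first by rewrite !mulr0n cos0 sin0 expr0.
rewrite exprS IHj [in RHS](mulrS _ j) cosD sinD /omega.
by apply/eqP; rewrite eq_complex /=; apply/andP; split; apply/eqP; ring.
Qed.

Lemma omega_prim n : (0 < n)%N -> n.-primitive_root (omega R n).
Proof.
move=> n_gt0; have n_neq0 : n%:R != 0 :> R by rewrite pnatr_eq0 -lt0n.
have wn1 : omega R n ^+ n = 1.
  rewrite omegaX -mulr_natr divfK // mulr_natl cos2pi sin2pi //.
have [m m_prim m_n] := prim_order_exists n_gt0 wn1.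
suff nm : n = m by rewrite {1}nm.
apply/eqP; rewrite eqn_leq andbC (dvdn_leq n_gt0 m_n) /= leqNgt.
apply/negP => lt_mn; have m_gt0 := prim_order_gt0 m_prim.
have : omega R n ^+ m = 1 := prim_expr_order m_prim.
(* An order m < n would give cos (2 x) = 1 with x strictly between 0 and pi, where sin x > 0. *)
rewrite omegaX => -[+ _]; set x : R := pi * m%:R / n%:R.
have -> : 2 * pi / n%:R *+ m = x *+ 2 by rewrite /x; field.
have sx : 0 < sin x.
  apply: sin_gt0_pi; rewrite /x divr_gt0 ?mulr_gt0 ?pi_gt0 ?ltr0n //=.
  by rewrite ltr_pdivrMr ?ltr0n // ltr_pM2l ?pi_gt0 // ltr_nat.
rewrite cos_mulr2n => c2; have := cos2Dsin2 x.
have : 0 < sin x ^+ 2 by rewrite exprn_gt0.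
lra.
Qed.

End Omega.

(** * The first three digits of a_(nm) *)

Section AperyDigits.
Variables (A B : int) (K : numFieldType) (m n : nat) (z : K).
Hypothesis hf : forall n k : nat, 0 <= (quadf int A B).[n%:Z, k%:Z].
Hypotheses (n_gt1 : (1 < n)%N) (n_coprime6 : gcdn n 6 = 1%N).
Hypothesis z_prim : n.-primitive_root z.

Let a n : {poly K} := map_poly intr (qapery A B n).

Let g0 (d : nat) : K := (a (m * d)%N).[1].
Let g1 (d : nat) : K := (a (m * n)%N)^`().[z ^+ d] * z ^+ d.
Let g2 (d : nat) : K := (a (m * n)%N)^`(2).[z ^+ d] * z ^+ (2 * d).
Let G0 := Gpoly g0 n.
Let G1 := Gpoly g1 n.
Let G2 := Gpoly g2 n.

Let n_gt0 : (0 < n)%N := ltnW n_gt1.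

Lemma proper_divisor_coprime6 d : (d %| n)%N -> d != n -> (5 <= n %/ d)%N.
Proof.
move=> d_n neq_dn; have nd_n := dvdn_div d_n.
have not_dvd p : prime p -> (p %| 6)%N -> (p %| n %/ d)%N = false.
  move=> p_pr p_6; apply/negP => p_nd.
  have : (p %| gcdn n 6)%N by rewrite dvdn_gcd p_6 (dvdn_trans p_nd).
  by rewrite n_coprime6 Euclid_dvd1.
have := not_dvd 2%N isT isT; have := not_dvd 3%N isT isT.
have nd_gt0 := dvdn_div_gt0 n_gt0 d_n.
have : (n %/ d)%N != 1%N.
  by apply: contra neq_dn => /eqP nd1; rewrite -[n](divnK d_n) nd1 mul1n.
by move: (n %/ d)%N nd_gt0 => [|[|[|[|[|c]]]]].
Qed.

Let n_ge5 : (5 <= n)%N.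
Proof.
by have := @proper_divisor_coprime6 1 (dvd1n n); rewrite divn1; apply; lia.
Qed.

(** The bound leaves room for the factor (q - 1)^2 of f2, whose degree is then at most n - 3. *)
Lemma size_Gpoly_coprime6 (g : nat -> K) : (size (Gpoly g n) <= n - 4)%N.
Proof.
by have := size_Gpoly g n_gt0 proper_divisor_coprime6; lia.
Qed.

(** With d = gcd(j, n), the functions g1 and g2 are evaluated at z^d and not at z^j. Both are
    primitive roots of the same order n/d, and the values of a, q a' and q^2 a'' at a root of unity
    depend only on its order. *)
Lemma horner_Gpoly_prim j : (0 < j < n)%N ->
  [/\ (a (n * m)).[z ^+ j] = G0.[z ^+ j],
      (qderiv (a (n * m))).[z ^+ j] = G1.[z ^+ j]
    & (qderiv (qderiv (a (n * m)))).[z ^+ j] = G2.[z ^+ j] + G1.[z ^+ j]].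
Proof.
move=> jP; set x := z ^+ j; set d := gcdn j n; set e := (n %/ d)%N.
have d_n : (d %| n)%N := dvdn_gcdr j n.
have d_gt0 : (0 < d)%N := dvdn_gt0 n_gt0 d_n.
have lt_dn : (d < n)%N.
  by have : (d <= j)%N by [apply: dvdn_leq; [lia | apply: dvdn_gcdl]]; lia.
have e_n : (e %| n)%N := dvdn_div d_n.
have dE : (n %/ e)%N = d by rewrite divnA // mulKn.
have e_gt1 : (1 < e)%N by rewrite -(ltn_pmul2r d_gt0) mul1n divnK.
have x_prim : e.-primitive_root x := exp_prim_root z_prim j.
have y_prim : e.-primitive_root (z ^+ d).
  by have := dvdn_prim_root z_prim e_n; rewrite dE.
have nmE : (n * m = e * (d * m))%N by rewrite mulnA divnK.
have [x0 x1 x2] := apery_at_root hf x_prim (d * m).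
have [y0 y1 y2] := apery_at_root hf y_prim (d * m).
have [dx1 dx2] := horner_derivs x (a (n * m)).
rewrite !(horner_Gpoly _ x_prim) // dE /g0 /g1 /g2 (mulnC m n) (mulnC m d).
rewrite -nmE in x0 x1 x2 y0 y1 y2.
have t1 : (qderiv (a (n * m))).[x] = (a (n * m))^`().[z ^+ d] * z ^+ d.
  by rewrite mulrC y1 -dx1 x1.
split=> //; rewrite -t1 exprM exprAC mulrC y2 -x2 dx2.
by rewrite subrK.
Qed.

Lemma apery_leading_digits (c0 c1 c2 r : {poly K}) :
    (size c0 < n)%N -> (size c1 < n)%N -> (size c2 < n)%N ->
    a (n * m) = c0 + c1 * qint K n + c2 * qint K n ^+ 2 + r * qint K n ^+ 3 ->
  [/\ c0 = G0,
      c1 = n%:R^-1 *: (('X - 1) * (G1 - 'X * G0^`()))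
    & c2 = (2 * n%:R ^+ 2)^-1 *:
        (('X - 1) ^+ 2
         * (G2 + G0^`(2) * 'X ^+ 2
            + ('X * G0^`() - G1) * (n%:R - 1)
            + 2 * 'X * (G0^`() - G1^`())))].
Proof.
move=> s0 s1 s2 aE; have n_neq0 : n%:R != 0 :> K by rewrite pnatr_eq0 -lt0n.
(* Apply 1, theta and theta^2 to the expansion at [x]. As [n] vanishes there, the cubic term
   disappears and each equation brings in one new digit. *)
have values j : (0 < j < n)%N -> let x := z ^+ j in
  [/\ x - 1 != 0, c0.[x] = G0.[x],
      (qderiv c0).[x] + c1.[x] * (n%:R / (x - 1)) = G1.[x]
    & (qderiv (qderiv c0)).[x] + 2 * (qderiv c1).[x] * (n%:R / (x - 1))
      + c1.[x] * ((n%:R ^+ 2 - 2 * n%:R * x / (x - 1)) / (x - 1))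
      + 2 * c2.[x] * (n%:R / (x - 1)) ^+ 2 = G2.[x] + G1.[x]].
  move=> jP x; have [v0 v1 v2] := horner_Gpoly_prim jP.
  have xn1 : x ^+ n = 1 by rewrite exprAC (prim_expr_order z_prim) expr1n.
  have x_neq1 : x != 1.
    by rewrite -(prim_order_dvd z_prim) gtnNdvd //; case/andP: jP.
  have [N0 N1 N2] := qderiv_qint xn1 x_neq1.
  move: v0 v1 v2; rewrite -/x aE exprS expr1 exprS expr2 => v0 v1 v2.
  rewrite subr_eq0; split=> //.
  - by rewrite -v0 !(hornerD, hornerM) N0 !(mulr0, mul0r, addr0).
  - rewrite -v1 !(qderivD, qderivM) !(hornerD, hornerM) N0 N1; ring.
  - rewrite -v2 !(qderivD, qderivM) !(hornerD, hornerM) N0 N1 N2; ring.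
have c0E : c0 = G0.
  apply: (eq_poly_prim_root z_prim) => // [|j /values[]//].
  by apply: leq_ltn_trans (size_Gpoly_coprime6 _) _; lia.
have sizeM (p q : {poly K}) i k :
    (size p <= i.+1)%N -> (size q <= k)%N -> (size (p * q)%R <= i + k)%N.
  by move=> sp sq; apply: leq_trans (size_polyMleq _ _) _; lia.
have sizeD (p q : {poly K}) k :
    (size p <= k)%N -> (size q <= k)%N -> (size (p + q)%R <= k)%N.
  by move=> sp sq; apply: leq_trans (size_polyD _ _) _; rewrite geq_max sp.
have sizeN (p : {poly K}) k : (size p <= k)%N -> (size (- p)%R <= k)%N.
  by rewrite size_polyN.
have sizeC (c : K) (p : {poly K}) k :
    (size p <= k)%N -> (size (c%:P * p)%R <= k)%N.
  by apply: (@sizeM _ _ 0); rewrite size_polyC_leq1.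
have sizeX1 (p : {poly K}) k :
    (size p <= k)%N -> (size (('X - 1) * p)%R <= k.+1)%N.
  by apply: (@sizeM _ _ 1); rewrite size_XsubC.
have sizeT (p : {poly K}) k : (size p <= k)%N -> (size (qderiv p) <= k)%N.
  exact: leq_trans (size_qderiv p).
have sizeG := size_Gpoly_coprime6.
have c1E : c1 = n%:R^-1 *: (('X - 1) * (G1 - qderiv G0)).
  apply: (eq_poly_prim_root z_prim) => // [|j /values[nz _ v1 _]].
    apply: leq_ltn_trans (size_scale_leq _ _) _.
    apply: (@leq_ltn_trans (n - 4).+1); last by lia.
    by apply: sizeX1; apply: sizeD; [apply: sizeG | apply/sizeN/sizeT/sizeG].
  by rewrite hornerZ hornerM hornerXsubC hornerD hornerN -v1 c0E; field;
    rewrite nz.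
(* The bracket of f2 written with theta, using q^2 G'' = theta^2 G - theta G. Since theta does not
   raise degrees, [W] inherits the bound on the size of the [Gpoly]s. *)
set W := G2 + (qderiv (qderiv G0) - qderiv G0)
  + (n%:R - 1)%:P * (qderiv G0 - G1) + 2%:P * (qderiv G0 - qderiv G1).
have c2E : c2 = (2 * n%:R ^+ 2)^-1 *: (('X - 1) * (('X - 1) * W)).
  apply: (eq_poly_prim_root z_prim) => // [|j /values[nz _ _ v2]].
    apply: leq_ltn_trans (size_scale_leq _ _) _.
    apply: (@leq_ltn_trans (n - 4).+2); last by lia.
    apply/sizeX1/sizeX1.
    by repeat first [exact: sizeG | apply/sizeD | apply/sizeC | apply/sizeN |
      apply/sizeT].
  (* The formula for [c1] is by now an identity of polynomials, so it may be differentiated. *)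
  have dc1 : (qderiv c1).[z ^+ j] = n%:R^-1 *
      (z ^+ j * (G1.[z ^+ j] - (qderiv G0).[z ^+ j])
       + (z ^+ j - 1) * ((qderiv G1).[z ^+ j] - (qderiv (qderiv G0)).[z ^+ j])).
    rewrite c1E qderivZ qderivM qderiv_XsubC hornerZ qderivD qderivN.
    by rewrite !(hornerD, hornerM, hornerN) hornerX hornerC.
  have c1x : c1.[z ^+ j] = n%:R^-1 *
      ((z ^+ j - 1) * (G1.[z ^+ j] - (qderiv G0).[z ^+ j])).
    by rewrite c1E hornerZ hornerM hornerXsubC hornerD hornerN.
  have {}v2 : c2.[z ^+ j] = (2 * n%:R ^+ 2)^-1 * (z ^+ j - 1) ^+ 2 *
      (G2.[z ^+ j] + G1.[z ^+ j] - (qderiv (qderiv G0)).[z ^+ j]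
       - 2 * (qderiv c1).[z ^+ j] * (n%:R / (z ^+ j - 1))
       - c1.[z ^+ j] * ((n%:R ^+ 2 - 2 * n%:R * z ^+ j / (z ^+ j - 1)) / (z
         ^+ j - 1))).
    by rewrite -v2 -/G0 c0E; field; rewrite nz.
  rewrite hornerZ !(hornerM ('X - 1)) hornerXsubC v2 dc1 c1x.
  rewrite /W !(hornerD, hornerN) !hornerM !hornerC !(hornerD, hornerN).
  by field; rewrite n_neq0 nz.
split=> //; first by rewrite c1E qderivE.
rewrite c2E; congr (_ *: _); rewrite /W !qderivE derivM derivX derivnS derivn1.
rewrite !polyCD polyCN !polyC_natr; ring.
Qed.

End AperyDigits.

(** * Specialization to omega_n, and integrality of the digits *)

Theorem theorem2p9 (R : realType) (A B : int)
    (hf : forall n k : nat, 0 <= (quadf int A B).[n%:Z, k%:Z]) :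
  let C : fieldType := complex R in
  let toC : {poly int} -> {poly C} := map_poly intr in
  let a (n : nat) : {poly C} := toC (qapery A B n) in
  let f : {poly {poly C}} := quadf C A B in
  let P1 : {poly {poly C}} := 'X * 'Y *+ 2 - 'Y ^+ 2 + f in
  let P2 : {poly {poly C}} :=
    P1 ^+ 2 + (3^-1)%:P *: ('X ^+ 2 * 'Y) - (6^-1)%:P *: ('X - 'Y) ^+ 2 in
  let P3 : {poly {poly C}} :=
    (6^-1)%:P *: 'X ^+ 2 - 'X * 'Y *+ 2 + 'Y ^+ 2 - f in
  (forall (n : nat) (w : C) (e : nat),
     (1 <= n)%N -> in_mu n w -> e.-primitive_root w ->
     [/\ (a n).[w] = (a (n %/ e)%N).[1],
         w * (a n)^`().[w] = e%:R ^+ 2 * apery_wt P1 (n %/ e)%N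
       & w ^+ 2 * (a n)^`(2).[w] = e%:R ^+ 4 * apery_wt P2 (n %/ e)%N
                                   + e%:R ^+ 2 * apery_wt P3 (n %/ e)%N])
  /\
  (forall m n : nat, (1 <= m)%N -> (2 <= n)%N -> gcdn n 6 = 1%N ->
     let g0 (d : nat) : C := (a (m * d)%N).[1] in
     let g1 (d : nat) : C := (a (m * n)%N)^`().[omega R n ^+ d] * omega R n ^+ d in
     let g2 (d : nat) : C :=
       (a (m * n)%N)^`(2).[omega R n ^+ d] * omega R n ^+ (2 * d) in
     let G0 := Gpoly g0 n in
     let G1 := Gpoly g1 n in
     let G2 := Gpoly g2 n in
     exists f0 f1 f2 : {poly int},
       [/\ (exists r : {poly int},
              qapery A B (n * m)%N
              = f0 + f1 * qint int n + f2 * qint int n ^+ 2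
                + r * qint int n ^+ 3),
           [/\ is_digit n (a (n * m)%N) 0 (toC f0),
               is_digit n (a (n * m)%N) 1 (toC f1)
             & is_digit n (a (n * m)%N) 2 (toC f2)]
         & [/\ toC f0 = G0,
               toC f1 = n%:R^-1 *: (('X - 1) * (G1 - 'X * G0^`()))
             & toC f2 = (2 * n%:R ^+ 2)^-1 *:
                 (('X - 1) ^+ 2
                  * (G2 + G0^`(2) * 'X ^+ 2
                     + ('X * G0^`() - G1) * (n%:R - 1)
                     + 2 * 'X * (G0^`() - G1^`())))]]).
Proof.
move=> C toC a f P1 P2 P3; split=> [n w e n_gt0 [j wE] w_prim|].
  (* The order of an element of mu_n divides n, so n = e (n / e) and the evaluation at primitive
     roots applies. *)
  have e_n : (e %| n)%N.
    rewrite (prim_order_dvd w_prim) wE exprAC.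
    by rewrite (prim_expr_order (omega_prim R n_gt0)) expr1n.
  have := apery_at_root hf w_prim (n %/ e)%N.
  by rewrite mulnC divnK.
move=> m n m_gt0 n_gt1 n_coprime6 g0 g1 g2 G0 G1 G2.
have n_gt0 := ltnW n_gt1; have z_prim := omega_prim R n_gt0.
set N := qint int n; have N_monic : N \is monic by rewrite qint_monic.
have size_mod (p : {poly int}) : (size (toC (p %% N)%R) < n)%N.
  apply: leq_ltn_trans (size_poly _ _) _.
  by rewrite -[X in (_ < X)%N](size_qint int n) ltn_modp monic_neq0.
(* As [n] is monic, successive Euclidean divisions over the integers produce the digits; mapped to
   the complex numbers, they keep degree < n - 1. *)
set F := qapery A B (n * m); set q1 := F %/ N; set q2 := q1 %/ N.
have FE : F = F %% N + (q1 %% N) * N + (q2 %% N) * N ^+ 2 + (q2 %/ N) * N ^+ 3.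
  have divE := Pdiv.IdomainMonic.divp_eq N_monic.
  by rewrite {1}(divE F) -/q1 {1}(divE q1) -/q2 {1}(divE q2); ring.
have aE : a (n * m)%N = toC (F %% N) + toC (q1 %% N) * qint C n
    + toC (q2 %% N) * qint C n ^+ 2 + toC (q2 %/ N) * qint C n ^+ 3.
  have NE : toC N = qint C n := map_qint _ n.
  by rewrite /a -/F -NE {1}FE /toC !(rmorphD, rmorphM, rmorphXn).
exists (F %% N), (q1 %% N), (q2 %% N); split; first by exists (q2 %/ N).
  by rewrite aE; apply: is_digit_leading.
exact: (apery_leading_digits hf n_gt1 n_coprime6 z_prim _ _ _ aE).
Qed.
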